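(* Every digraph $D$ with $\dim(D)\le 2$ is transitive.
   Context: All digraphs are finite and have simple underlying graphs (no loops, no multiple arcs, and at most one arc between any two vertices). For an integer $d\ge 0$ write $[d]=\{1,\dots,d\}$ (with $\mathbb{R}^0=\{0\}$). For $x,y\in\mathbb{R}^d$ let $\mathcal{G}_{x>y}=\{i\in[d]: x_i>y_i\}$. The weak majority relation: $x\succ y$ iff $|\mathcal{G}_{x>y}|-|\mathcal{G}_{y>x}|>0$. A map $f:V(D)\to\mathbb{R}^d$ is an $\mathbb{R}^d$-realizer of $D$ if for all vertices $x,y$: $(x,y)\in A(D)$ iff $f(x)\succ f(y)$. The weak majority dimension $\dim(D)$ is the minimum nonnegative integer $d$ such that $D$ has an $\mathbb{R}^d$-realizer (such $d$ always exists). A digraph $D$ is transitive if $(x,z)\in A(D)$ whenever $(x,y)\in A(D)$ and $(y,z)\in A(D)$. *)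

(* Defs.v *)
From HB Require Import structures.
From mathcomp Require Import all_boot all_order all_algebra.
From mathcomp Require Import boolp reals.
Set Implicit Arguments.
Unset Strict Implicit.
Unset Printing Implicit Defensive.
Import Order.TTheory GRing.Theory Num.Theory.
Local Open Scope ring_scope.

Record digraph := Digraph {
  vertex : finType;
  darc : rel vertex;
  darc_irr : forall x, ~~ darc x x;
  darc_asym : forall x y, darc x y -> ~~ darc y x }.

Arguments darc : clear implicits.

Definition gtset (R : realType) (d : nat) (x y : 'rV[R]_d) : {set 'I_d} :=
  [set i | y 0 i < x 0 i].

Definition majority (R : realType) (d : nat) (x y : 'rV[R]_d) : bool :=
  0 < #|gtset x y|%:Z - #|gtset y x|%:Z.

Definition realizer (R : realType) (D : digraph) (d : nat)
    (f : vertex D -> 'rV[R]_d) : Prop :=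
  forall x y : vertex D, darc D x y <-> majority (f x) (f y).

Definition realizable (R : realType) (D : digraph) (d : nat) : Prop :=
  exists f : vertex D -> 'rV[R]_d, realizer f.

Lemma margin_sum (R : realType) (d : nat) (x y : 'rV[R]_d) :
  #|gtset x y|%:Z - #|gtset y x|%:Z = \sum_(i < d) sgz (x 0 i - y 0 i).
Proof.
rewrite -!sum1_card -!natz !natr_sum big_mkcond /=.
rewrite [X in _ - X]big_mkcond -sumrB.
apply: eq_bigr => i _; rewrite !inE.
case: ltrgtP => [lt_yx|lt_xy|->]; last by rewrite !subrr sgz0.
- by rewrite gtr0_sgz ?subr_gt0.
- by rewrite ltr0_sgz ?subr_lt0.
Qed.

(* A realizer always exists: give each arc (u, v) two coordinates, in which
   the vertices are ordered u > v > others and others > u > v. *)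
Definition arc_coord (D : digraph) (p : vertex D * vertex D) (b : bool)
    (w : vertex D) : int :=
  if ~~ darc D p.1 p.2 then 0
  else if w == p.1 then (if b then 2 else 1)
  else if w == p.2 then (if b then 1 else 0)
  else (if b then 0 else 2).

Lemma arc_coord_margin (D : digraph) (p : vertex D * vertex D)
    (x y : vertex D) :
  \sum_(b : bool) sgz (arc_coord p b x - arc_coord p b y) =
  if p == (x, y) then (darc D x y)%:Z *+ 2
  else if p == (y, x) then - ((darc D y x)%:Z *+ 2) else 0.
Proof.
case: p => u v; rewrite big_bool /arc_coord /= !xpair_eqE.
case uv: (darc D u v) => /=; last first.
  rewrite subrr.
  case: ifP => [/andP[/eqP <- /eqP <-]|_]; first by rewrite uv.
  by case: ifP => [/andP[/eqP <- /eqP <-]|_]; rewrite ?uv.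
have neq_uv : u != v by apply: contraTneq uv => ->; exact: darc_irr.
rewrite ![_ == u]eq_sym ![_ == v]eq_sym.
have [ux|nux] := eqVneq u x; have [uy|nuy] := eqVneq u y;
have [vx|nvx] := eqVneq v x; have [vy|nvy] := eqVneq v y => //=; subst;
  by rewrite ?eqxx ?uv in neq_uv *.
Qed.

Lemma realizable_ex (R : realType) (D : digraph) :
  exists d, `[< realizable R D d >].
Proof.
pose I := ((vertex D * vertex D) * bool)%type.
exists #|{: I}|; apply/asboolP.
exists (fun v => \row_i (arc_coord (enum_val i).1 (enum_val i).2 v)%:~R).
move=> x y; rewrite /majority margin_sum.
under eq_bigr do rewrite !mxE -intrB sgz_int.
rewrite -(big_enum_val (fun q : I =>
  sgz (arc_coord q.1 q.2 x - arc_coord q.1 q.2 y))) /=.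
rewrite (eq_bigl xpredT) //.
rewrite -(pair_bigA _ (fun p b => sgz (arc_coord p b x - arc_coord p b y))) /=.
under eq_bigr do rewrite arc_coord_margin.
have [<-|neq_xy] := eqVneq x y.
  rewrite big1 ?ltxx => [|p _]; last by rewrite (negPf (darc_irr x)) !if_same.
  by split=> //; rewrite (negPf (darc_irr x)).
have neq_yx : ((y, x) == (x, y)) = false.
  by apply/negbTE; rewrite xpair_eqE negb_and eq_sym neq_xy.
rewrite (bigD1 (x, y)) //= eqxx (bigD1 (y, x)) ?neq_yx //= eqxx.
rewrite big1 => [|p /andP[/negPf -> /negPf ->]] //.
rewrite addr0; have := @darc_asym D x y.
by case: (darc D x y) (darc D y x) => [] [] // /(_ isT).
Qed.

Definition wmdim (R : realType) (D : digraph) : nat := ex_minn (realizable_ex R D).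

(* Main.v *)
(* In dimension at most two, a single coordinate lost against an opponent leaves
   at most one coordinate to win, so a strict majority is exactly Pareto
   dominance, which is transitive. *)
Require Import Defs.
From mathcomp Require Import all_boot reals.
From mathcomp Require Import all_order all_algebra boolp.
Set Implicit Arguments.
Unset Strict Implicit.
Unset Printing Implicit Defensive.
Import Order.TTheory GRing.Theory Num.Theory.

(** The coordinates won by [x] and those won by [y] are disjoint, so for [d <= 2] they number at
    most 2 together. Majority is then the strict part of the componentwise order ([majority_le2P]),
    hence transitive ([majority_le2_trans]), and a realizer carries this over to arcs. *)

Lemma majorityE (R : realType) (d : nat) (x y : 'rV[R]_d) :
  majority x y = (#|gtset y x| < #|gtset x y|)%N.
Proof. by rewrite /majority subr_gt0 ltz_nat. Qed.

Lemma gtset_disjoint (R : realType) (d : nat) (x y : 'rV[R]_d) :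
  [disjoint gtset x y & gtset y x].
Proof.
by apply/pred0P => i; rewrite /= !inE; case: ltgtP.
Qed.

Lemma leq_add_card_gtset (R : realType) (d : nat) (x y : 'rV[R]_d) :
  (#|gtset x y| + #|gtset y x| <= d)%N.
Proof.
have /eqP <- : #|gtset x y :|: gtset y x| == (#|gtset x y| + #|gtset y x|)%N.
  by rewrite (leq_card_setU (gtset x y) (gtset y x)).2 gtset_disjoint.
by rewrite -[leqRHS]card_ord max_card.
Qed.

Lemma majority_le2P (R : realType) (d : nat) (x y : 'rV[R]_d) : (d <= 2)%N ->
  reflect (gtset y x = set0 /\ gtset x y != set0) (majority x y).
Proof.
move=> d_le2; rewrite majorityE; apply: (iffP idP) => [lt_yx | [-> ]]; last first.
  by rewrite cards0 card_gt0.
have le2 := leq_trans (leq_add_card_gtset x y) d_le2.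
split; last by rewrite -card_gt0 (leq_trans _ lt_yx).
apply/eqP; rewrite -cards_eq0 -leqn0.
rewrite leqNgt; apply/negP => gt0; move: le2; rewrite leqNgt => /negP[].
(* One win for [y] forces two for [x]: three coordinates in all. *)
exact: (@leq_add 2 1 _ _ (leq_ltn_trans gt0 lt_yx) gt0).
Qed.

Lemma majority_le2_trans (R : realType) (d : nat) :
  (d <= 2)%N -> transitive (@majority R d).
Proof.
move=> d_le2 y x z /(majority_le2P _ _ d_le2)[yx0 xy_neq0].
move=> /(majority_le2P _ _ d_le2)[zy0 _].
have le_yx i : (y 0 i <= x 0 i)%R.
  by move/setP/(_ i): yx0; rewrite !inE leNgt => ->.
have le_zy i : (z 0 i <= y 0 i)%R.
  by move/setP/(_ i): zy0; rewrite !inE leNgt => ->.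
apply/(majority_le2P _ _ d_le2); split.
  by apply/setP => i; rewrite !inE ltNge (le_trans (le_zy i)).
(* Where [x] beats [y] it also beats [z], since [z] is at most [y] there. *)
have /set0Pn[i] := xy_neq0; rewrite inE => lt_yx.
by apply/set0Pn; exists i; rewrite inE (le_lt_trans (le_zy i)).
Qed.

Theorem theorem3p4 (R : realType) (D : digraph) :
  (wmdim R D <= 2)%N -> transitive (darc D).
Proof.
(* The minimum is attained, which supplies a realizer [f] in dimension [d <= 2]. *)
rewrite /wmdim; case: ex_minnP => d /asboolP[f fP] _ d_le2 y x z.
move=> /fP xy /fP yz; apply/fP.
exact: majority_le2_trans xy yz.
Qed.
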